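(* If there exist a generalized Hadamard matrix $GH(g,1)$ over a finite abelian group and linked UFS Latin squares $L_{i,j}$ ($i,j\in\{1,\ldots,f\}$, $i\neq j$) of order $g+1$, then there exists a linked system of symmetric group divisible designs (indexed by $\{1,\ldots,f\}$) with parameters $(g^2(g+1),g(g+1),g+1,g^2,g,g+1)$ and constants $(\sigma,\tau)=(2g,g)$.
   Context: $I_n,J_n$ denote the identity and all-ones matrices of order $n$; $\otimes$ is the Kronecker product. Let $G$ be an additively written abelian group of order $g$. A generalized Hadamard matrix $GH(g,\lambda)$ over $G$ is a square matrix $H=(h_{ij})$ of order $g\lambda$ with entries in $G$ such that for all distinct rows $i,k$ the multiset $\{h_{ij}-h_{kj}:1\le j\le g\lambda\}$ contains each element of $G$ exactly $\lambda$ times. A $v\times v$ $(0,1)$-matrix $A$ ($v=mn$) is the incidence matrix of a symmetric group divisible design with parameters $(v,k,m,n,\lambda_1,\lambda_2)$ if $AA^\top=A^\top A=kI_v+\lambda_1(I_m\otimes J_n-I_v)+\lambda_2(J_v-I_m\otimes J_n)$. A linked system of such designs with constants $\sigma,\tau$ is a family of such incidence matrices $A_{i,j}$ ($i\neq j$ in $\{1,\ldots,f\}$) with $A_{i,j}^\top=A_{j,i}$ and $A_{i,j}A_{j,l}=\sigma A_{i,l}+\tau(J_v-A_{i,l})$ for all pairwise distinct $i,j,l$. Two Latin squares $L,L'$ of order $N$ on the same symbol set are UFS if for every row $i$ of $L$ and every row $j$ of $L'$ there is exactly one column $a$ with $L(i,a)=L'(j,a)$; then the square obtained from $L$ and $L'$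 (in this order) is the $N\times N$ array whose $(i,j)$-entry is $L(i,a)=L'(j,a)$ for this unique $a$. For $f\ge3$, Latin squares $L_{i,j}$ ($i\ne j$) on the same symbol set are linked UFS Latin squares if for all pairwise distinct $i,j,k$, $L_{i,k}$ and $L_{j,k}$ are UFS and the square obtained from $L_{i,k}$ and $L_{j,k}$ equals $L_{i,j}$. *)

(* Defs.v *)
From HB Require Import structures.
From mathcomp Require Import all_boot all_order all_algebra.
From mathcomp Require Export mxtens.

Set Implicit Arguments.
Unset Strict Implicit.
Unset Printing Implicit Defensive.

Import GRing.Theory.
Local Open Scope ring_scope.

Definition gen_hadamard (g lambda : nat) (G : finZmodType)
    (H : 'M[G]_(g * lambda)) : Prop :=
  #|G| = g /\
  forall i k : 'I_(g * lambda), i != k ->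
  forall x : G, #|[set j | H i j - H k j == x]| = lambda.

Definition ones_mx (n : nat) : 'M[int]_n := const_mx 1.

(* A *t B is the Kronecker product of A and B. *)
Definition symGDD (v k m n lambda1 lambda2 : nat) (A : 'M[int]_(m * n)) : Prop :=
  let I_v : 'M[int]_(m * n) := 1%:M in
  let J_v := ones_mx (m * n) in
  let K := (1%:M : 'M[int]_m) *t ones_mx n in
  let rhs := k%:R *: I_v + lambda1%:R *: (K - I_v) + lambda2%:R *: (J_v - K) in
  [/\ v = (m * n)%N,
      forall p q, A p q = 0 \/ A p q = 1,
      A *m A^T = rhs
    & A^T *m A = rhs].

(* The values A i i are unconstrained: only the A i j with i != j are part
   of the system. *)
Definition linked_symGDD (f v k m n lambda1 lambda2 sigma tau : nat)
    (A : 'I_f -> 'I_f -> 'M[int]_(m * n)) : Prop :=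
  [/\ forall i j, i != j -> symGDD v k lambda1 lambda2 (A i j),
      forall i j, i != j -> (A i j)^T = A j i
    & forall i j l, i != j -> j != l -> i != l ->
      A i j *m A j l =
        sigma%:R *: A i l + tau%:R *: (ones_mx (m * n) - A i l)].

Definition latin_square (N : nat) (S : finType) (L : 'M[S]_N) : Prop :=
  [/\ #|S| = N,
      forall (i : 'I_N) (s : S), exists! a, L i a = s
    & forall (a : 'I_N) (s : S), exists! i, L i a = s].

Definition UFS (N : nat) (S : finType) (L L' : 'M[S]_N) : Prop :=
  forall i j : 'I_N, exists! a, L i a = L' j a.

(* The default L i j is never used when L and L' are UFS. *)
Definition UFS_square (N : nat) (S : finType) (L L' : 'M[S]_N) : 'M[S]_N :=
  \matrix_(i, j)
    if [pick a | L i a == L' j a] is Some a then L i a else L i j.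

(* As for linked_symGDD, the values L i i are unconstrained. *)
Definition linked_UFS (f N : nat) (S : finType)
    (L : 'I_f -> 'I_f -> 'M[S]_N) : Prop :=
  [/\ (3 <= f)%N,
      forall i j, i != j -> latin_square (L i j)
    & forall i j k, i != j -> j != k -> i != k ->
      UFS (L i k) (L j k) /\ UFS_square (L i k) (L j k) = L i j].

(* Main.v *)
Require Import Defs.
From HB Require Import structures.
From mathcomp Require Import all_boot all_order all_algebra.

Set Implicit Arguments.
Unset Strict Implicit.
Unset Printing Implicit Defensive.

Import GRing.Theory.
Local Open Scope ring_scope.

(** The rows [h_i] of [H] give [g] maps [(a, x) |-> x - h_ia] on the [g^2]
    points [(a, x)], and [(a, x) |-> a] gives one more; their fibres are the
    [g + 1] parallel classes of an affine plane of order [g]. The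
    equivalence matrices [C_s] of these classes satisfy [C_s C_s = g C_s],
    [C_s C_t = J] for [s <> t], and [\sum_s C_s = J + g I]. Replacing each
    symbol [s] of the Latin square [L_ij] by [C_s] yields [A_ij]: its rows
    (or columns) at distinct indices never agree, so the off-diagonal blocks
    of [A_ij A_ij^T] are [(g + 1) J]; and rows of [L_ij] and [L_lj] agree
    exactly once, in the symbol prescribed by [L_il], so the blocks of
    [A_ij A_jl] are [g C_s + g J]. *)

(** * Block matrices, indexed compatibly with the Kronecker product *)

Definition blocks_mx (m n : nat) (B : 'I_m -> 'I_m -> 'M[int]_n) :
    'M[int]_(m * n) :=
  \matrix_(p, q) B (mxtens_unindex p).1 (mxtens_unindex q).1
                   (mxtens_unindex p).2 (mxtens_unindex q).2.

Lemma blocks_mxE m n (B : 'I_m -> 'I_m -> 'M[int]_n) i j k l :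
  blocks_mx B (mxtens_index (i, k)) (mxtens_index (j, l)) = B i j k l.
Proof. by rewrite mxE !mxtens_indexK. Qed.

Lemma eq_blocks_mx m n (B B' : 'I_m -> 'I_m -> 'M[int]_n) :
  (forall i j, B i j = B' i j) -> blocks_mx B = blocks_mx B'.
Proof. by move=> eqB; apply/matrixP=> p q; rewrite !mxE eqB. Qed.

Lemma tr_blocks_mx m n (B : 'I_m -> 'I_m -> 'M[int]_n) :
  (blocks_mx B)^T = blocks_mx (fun i j => (B j i)^T).
Proof. by apply/matrixP=> p q; rewrite !mxE. Qed.

Lemma mul_blocks_mx m n (B B' : 'I_m -> 'I_m -> 'M[int]_n) :
  blocks_mx B *m blocks_mx B' =
    blocks_mx (fun i j => \sum_k B i k *m B' k j).
Proof.
apply/matrixP=> p q.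
case: (mxtens_indexP p) => i a; case: (mxtens_indexP q) => j b.
rewrite blocks_mxE mxE summxE.
under [RHS]eq_bigr => k _ do rewrite mxE.
rewrite pair_big /= (reindex (@mxtens_index m n)) /=; last first.
  by exists (@mxtens_unindex m n) => k _;
    rewrite (mxtens_indexK, mxtens_unindexK).
by apply: eq_bigr => -[k c] _; rewrite !blocks_mxE.
Qed.

(** The all-ones part of a diagonal block already puts [l1] on the diagonal, so with the valency
    written [k + l1] only [k] is left for the identity and no subtraction occurs. *)
Lemma blocks_mx_GDD (m n k l1 l2 : nat) :
  let K := (1%:M : 'M[int]_m) *t ones_mx n in
  (k + l1)%:R *: 1%:M + l1%:R *: (K - 1%:M) + l2%:R *: (ones_mx (m * n) - K) =
  blocks_mx (fun i j => if i == j then k%:R *: 1%:M + l1%:R *: ones_mx n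
                        else l2%:R *: ones_mx n).
Proof.
apply/matrixP=> p q.
case: (mxtens_indexP p) => i a; case: (mxtens_indexP q) => j b.
rewrite blocks_mxE !(mxE, mxtens_indexK) /=.
rewrite (can_eq (@mxtens_indexK _ _)) xpair_eqE.
case: (i == j) => /=; last by rewrite !mxE mul0r !subr0 !mulr0 !add0r.
rewrite !mxE !mul1r subrr mulr0 addr0 mulr1 natrD mulrDl mulrBr mulr1.
by rewrite -addrA [X in _ + X]addrC subrK.
Qed.

(** * Equivalence matrices of partitions *)

Section ClassMatrix.

Variables (n : nat) (T : finType).

Definition class_mx (l : 'I_n -> T) : 'M[int]_n :=
  \matrix_(p, q) (l p == l q)%:R.

Lemma tr_class_mx l : (class_mx l)^T = class_mx l.
Proof. by apply/matrixP=> p q; rewrite !mxE eq_sym. Qed.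

Lemma mul_class_mx l l' p q :
  (class_mx l *m class_mx l') p q =
    #|[set r | (l r == l p) && (l' r == l' q)]|%:R.
Proof.
rewrite mxE -sum1dep_card natr_sum [RHS]big_mkcond /=; apply: eq_bigr => r _.
by rewrite !mxE [l p == _]eq_sym; case: eqP; case: eqP.
Qed.

End ClassMatrix.

(** * Nets with [g + 1] classes on [g ^ 2] points; [l s p] labels the line of class [s] through
    [p] *)

Section Net.

Variables (g : nat) (T S : finType) (l : S -> 'I_(g ^ 2) -> T).
Hypotheses (cardT : #|T| = g) (cardS : #|S| = (g + 1)%N).
Hypothesis l_inj : forall s t, s != t -> injective (fun p => (l s p, l t p)).

(** The points and [T * T] both have [g ^ 2] elements, so the injection given by two classes is a
    bijection. *)
Lemma net_meet s t u v :
  s != t -> #|[set r | (l s r == u) && (l t r == v)]| = 1%N.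
Proof.
move=> st; have [h lh hl] : bijective (fun p => (l s p, l t p)).
  apply: inj_card_bij (l_inj st) _.
  by rewrite card_prod cardT card_ord expnS expn1.
apply/eqP/cards1P; exists (h (u, v)); apply/setP=> r.
by rewrite !inE -xpair_eqE -(can_eq hl) lh.
Qed.

(** Each of the [g] lines of a second class [t] cuts the given line in exactly one point. *)
Lemma net_line s u : #|[set r | l s r == u]| = g.
Proof.
have [t st] : exists t, s != t.
  (* The label [u] witnesses [g > 0], so there are at least two classes. *)
  have : (0 < #|predC1 s|)%N.
    by have := cardC1 s; rewrite cardS addn1 /= => ->;
       rewrite -cardT; apply/card_gt0P; exists u.
  by case/card_gt0P=> t; rewrite inE eq_sym; exists t.
rewrite -sum1_card (partition_big (l t) xpredT) //= -[RHS]cardT -sum1_card.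
apply: eq_bigr => v _; rewrite -[RHS](net_meet u v st) -[RHS]sum1_card.
by apply: eq_bigl => r; rewrite !inE.
Qed.

(** Two lines of the same class are equal, with [g] common points, or disjoint. *)
Lemma mul_class_mx_id s :
  class_mx (l s) *m class_mx (l s) = g%:R *: class_mx (l s).
Proof.
apply/matrixP=> p q; rewrite mul_class_mx !mxE; case: eqP => [->|neq].
  by under eq_finset do rewrite andbb; rewrite net_line mulr1.
rewrite mulr0 (_ : [set r | _] = set0) ?cards0 //.
by apply/setP=> r; rewrite !inE; apply/negP=> /andP[/eqP-> /eqP].
Qed.

Lemma mul_class_mx_neq s t :
  s != t -> class_mx (l s) *m class_mx (l t) = ones_mx (g ^ 2).
Proof.
by move=> st; apply/matrixP=> p q; rewrite mul_class_mx net_meet // !mxE.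
Qed.

(* Two points lie on at most one line, and counting the pairs (line through p,
   point on it) forces equality. *)
Lemma net_join p q : p != q -> #|[set s | l s p == l s q]| = 1%N.
Proof.
pose N q' := #|[set s | l s p == l s q']|.
have N_le1 q' : p != q' -> (N q' <= 1)%N.
  move=> pq'; apply: contraR pq'; rewrite -ltnNge => /card_gt1P[s [t []]].
  by rewrite !inE => /eqP ls /eqP lt st; apply/eqP/(l_inj st); rewrite ls lt.
have Np : N p = (g + 1)%N.
  by rewrite /N -cardS -cardsT; apply: eq_card => s; rewrite !inE eqxx.
have Nsum : (\sum_q' N q' = (g + 1) * g)%N.
  rewrite -cardS -sum_nat_const /N.
  under eq_bigr do rewrite -sum1_card big_mkcond.
  rewrite exchange_big; apply: eq_bigr => s _.
  rewrite -[RHS](net_line s (l s p)) -[RHS]sum1_card [RHS]big_mkcond.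
  by apply: eq_bigr => q' _; rewrite !inE eq_sym.
have g_gt0 : (0 < g)%N.
  by have := leq_ltn_trans (leq0n _) (ltn_ord p); rewrite expn_gt0 orbF.
(* Removing the term [N p] from the total leaves [(g + 1) * g - (g + 1) = g ^ 2 - 1], the number of
   other points, so the bound 1 is attained termwise. *)
have : (\sum_(q' | p != q') N q' == \sum_(q' | p != q') 1)%N.
  rewrite sum1_card -(eqn_add2l (N p)).
  have := Nsum; rewrite (bigD1 p) //=.
  under eq_bigl do rewrite eq_sym.
  move=> ->; rewrite Np.
  have -> : #|(fun q' => p != q')| = (g ^ 2).-1.
    rewrite -[in RHS](card_ord (g ^ 2)) -(cardC1 p).
    by apply: eq_card => q'; rewrite !inE eq_sym.
  rewrite -subn1 -addnA subnKC ?expn_gt0 ?g_gt0 //.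
  by rewrite mulnDl mul1n addnC expnS expn1.
have [_ ->] := leqif_sum (fun q' pq' => leqif_eq (N_le1 q' pq')).
by move=> /forall_inP/(_ q) Nq pq; apply/eqP/Nq.
Qed.

(** Entry [(p, q)] counts the classes having a line through both points: [g + 1] if [p = q], and 1
    otherwise by [net_join]. *)
Lemma sum_class_mx : \sum_s class_mx (l s) = g%:R *: 1%:M + ones_mx (g ^ 2).
Proof.
apply/matrixP=> p q; rewrite summxE !mxE.
transitivity (#|[set s | l s p == l s q]|%:R : int).
  rewrite -sum1dep_card natr_sum [RHS]big_mkcond; apply: eq_bigr => s _.
  by rewrite !mxE; case: eqP.
have [<-|pq] := eqVneq p q; last by rewrite net_join // mulr0 add0r.
rewrite mulr1 natr1 -addn1 -cardS -cardsT; congr _%:R.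
by apply: eq_card => s; rewrite !inE eqxx.
Qed.

End Net.

(** * The net of a generalized Hadamard matrix *)

Lemma gen_hadamard_net (g : nat) (G : finZmodType) (H : 'M[G]_(g * 1))
    (S : finType) : gen_hadamard H -> #|S| = (g + 1)%N ->
  exists l : S -> 'I_(g ^ 2) -> G,
    forall s t, s != t -> injective (fun p => (l s p, l t p)).
Proof.
case=> cardG Hdiff cardS.
have card_pt : #|{: 'I_(g * 1) * G}| = (g ^ 2)%N.
  by rewrite card_prod card_ord cardG muln1 expnS expn1.
have card_opt : #|{: option 'I_(g * 1)}| = #|S|.
  by rewrite card_option card_ord muln1 cardS addn1.
have cardIG : #|{: 'I_(g * 1)}| = #|G| by rewrite card_ord muln1.
pose pt k : 'I_(g * 1) * G := enum_val (cast_ord (esym card_pt) k).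
(* [Some i] is the class of row [i] of [H], and [None] the extra class of lines with constant first
   coordinate. *)
pose cl (s : S) : option 'I_(g * 1) :=
  enum_val (cast_ord (esym card_opt) (enum_rank s)).
(* An arbitrary injection that moves the labels of the extra class into [G], where the other labels
   live. *)
pose gen (a : 'I_(g * 1)) : G := enum_val (cast_ord cardIG (enum_rank a)).
have pt_inj : injective pt by move=> k k' /enum_val_inj/cast_ord_inj.
have cl_inj : injective cl.
  by move=> s t /enum_val_inj/cast_ord_inj/enum_rank_inj.
have gen_inj : injective gen.
  by move=> a b /enum_val_inj/cast_ord_inj/enum_rank_inj.
exists (fun s k => if cl s is Some i then (pt k).2 - H i (pt k).1
                   else gen (pt k).1).
move=> s t st k k' /= [ls lt].
(* As [cl] is injective, [s] or [t] comes from a row of [H]; its label determines the second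
   coordinate once the first is known. *)
suff eq1 : (pt k).1 = (pt k').1.
  have : (pt k).2 = (pt k').2.
    case Es: (cl s) ls => [i|] ls; first by move: ls; rewrite eq1 => /addIr.
    case Et: (cl t) lt => [i|] lt; first by move: lt; rewrite eq1 => /addIr.
    by case/eqP: st; apply: cl_inj; rewrite Es Et.
  move=> eq2; apply: pt_inj.
  by rewrite [LHS]surjective_pairing eq1 eq2 -surjective_pairing.
case Es: (cl s) ls => [i|]; last by move/gen_inj.
case Et: (cl t) lt => [j|]; last by move/gen_inj.
move=> lj li.
have ij : i != j.
  by apply: contraNneq st => ij; apply/eqP/cl_inj; rewrite Es Et ij.
(* Subtracting the two label equations shows that rows [i] and [j] have the same difference in both
   columns; as [lambda = 1], the columns coincide. *)
have /eqP/cards1P[a0 Ha0] := Hdiff i j ij (H i (pt k).1 - H j (pt k).1).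
have : (pt k).1 \in [set a0] by rewrite -Ha0 inE.
have : (pt k').1 \in [set a0].
  rewrite -Ha0 inE.
  have e (x y z : G) : y - z = (x - z) - (x - y).
    by rewrite opprB [RHS]addrC addrA subrK.
  by rewrite (e (pt k').2) -li -lj -e.
by rewrite !inE => /eqP-> /eqP->.
Qed.

(** * Substituting class matrices for the symbols of a Latin square *)

Section LatinSubstitution.

Variables (N n g : nat) (S : finType) (C : S -> 'M[int]_n).
Hypothesis C_tr : forall s, (C s)^T = C s.
Hypothesis C_sqr : forall s, C s *m C s = g%:R *: C s.
Hypothesis C_mul : forall s t, s != t -> C s *m C t = ones_mx n.
Hypothesis C_sum : \sum_s C s = g%:R *: 1%:M + ones_mx n.

Definition subst_mx (M : 'M[S]_N) := blocks_mx (fun i j => C (M i j)).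

Lemma tr_subst_mx M : (subst_mx M)^T = subst_mx M^T.
Proof. by rewrite tr_blocks_mx; apply: eq_blocks_mx => i j; rewrite C_tr mxE. Qed.

Lemma tr_latin_square (M : 'M[S]_N) : latin_square M -> latin_square M^T.
Proof.
case=> cS rows cols; split=> // i s.
  by case: (cols i s) => a [<- a_uniq]; exists a; split=> [|b];
    rewrite mxE //; exact: a_uniq.
by case: (rows i s) => a [<- a_uniq]; exists a; split=> [|b];
    rewrite mxE //; exact: a_uniq.
Qed.

(** A diagonal block is [g] times the sum of [C] along a row of [M]. The row meets every symbol
    once, so [C_sum] applies. *)
Lemma mul_subst_mx_tr (M : 'M[S]_N) : latin_square M ->
  subst_mx M *m (subst_mx M)^T =
  blocks_mx (fun i j => if i == j then (g * g)%:R *: 1%:M + g%:R *: ones_mx n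
                        else N%:R *: ones_mx n).
Proof.
case=> cS rows cols; rewrite tr_subst_mx mul_blocks_mx.
apply: eq_blocks_mx => i j; under eq_bigr do rewrite mxE.
have [<-|ij] := eqVneq i j; last first.
  rewrite (eq_bigr (fun=> ones_mx n)).
    by rewrite sumr_const card_ord scaler_nat.
  move=> a _; apply: C_mul; apply: contraNneq ij => Mij.
  have [b [_ b_uniq]] := cols a (M j a).
  by rewrite -(b_uniq i Mij) -(b_uniq j erefl).
have M_inj : injective (M i).
  by move=> a b Mab; have [c [_ c_uniq]] := rows i (M i b);
     rewrite -(c_uniq a Mab) -(c_uniq b erefl).
have M_bij : bijective (M i).
  by apply: inj_card_bij M_inj _; rewrite card_ord cS.
under eq_bigr do rewrite C_sqr.
have C_row : \sum_a C (M i a) = \sum_s C s.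
  by rewrite [RHS](reindex (M i)) //; exact: onW_bij.
by rewrite -scaler_sumr C_row C_sum scalerDr scalerA -natrM.
Qed.

Lemma mul_subst_mx_UFS (M M' : 'M[S]_N) : UFS M M' ->
  subst_mx M *m (subst_mx M')^T =
  blocks_mx (fun i j => g%:R *: C (UFS_square M M' i j) +
                        N.-1%:R *: ones_mx n).
Proof.
move=> ufs; rewrite tr_subst_mx mul_blocks_mx; apply: eq_blocks_mx => i j.
have [a [Ma a_uniq]] := ufs i j; rewrite (bigD1 a) //= !mxE.
case: pickP => [b /eqP Mb|/(_ a)]; last by rewrite Ma eqxx.
rewrite -{b Mb}(a_uniq b Mb) -Ma C_sqr; congr (_ + _).
rewrite (eq_bigr (fun=> ones_mx n)) => [|b ba].
  by rewrite sumr_const cardC1 card_ord scaler_nat.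
by rewrite mxE; apply: C_mul; apply: contraNneq ba => /a_uniq ->.
Qed.

End LatinSubstitution.

Lemma tr_UFS_square (N : nat) (S : finType) (M M' : 'M[S]_N) :
  UFS M M' -> (UFS_square M M')^T = UFS_square M' M.
Proof.
move=> ufs; apply/matrixP=> j i; rewrite !mxE.
have [a [Ma a_uniq]] := ufs i j.
case: pickP => [b /eqP Mb|/(_ a)]; last by rewrite Ma eqxx.
case: pickP => [c /eqP Mc|/(_ a)]; last by rewrite Ma eqxx.
by rewrite -(a_uniq b Mb) -(a_uniq c (esym Mc)).
Qed.

(** As [f >= 3], a third index [k] exists; [L i j] and [L j i] are the squares obtained from [L i k]
    and [L j k] in the two orders. *)
Lemma tr_linked_UFS (f N : nat) (S : finType) (L : 'I_f -> 'I_f -> 'M[S]_N) i j :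
  linked_UFS L -> i != j -> (L i j)^T = L j i.
Proof.
case=> f3 _ linked ij.
have [k] : exists k, k \notin [set i; j].
  apply/existsP; rewrite -negb_forall; apply/negP=> /forallP all2.
  have : (#|[set i; j]| < f)%N by rewrite cards2 ij.
  have -> : [set i; j] = setT by apply/setP=> k; rewrite all2 inE.
  by rewrite cardsT card_ord ltnn.
rewrite !inE negb_or ; rewrite ![k == _]eq_sym => /andP[ik jk].
have [ufs <-] := linked i j k ij jk ik; rewrite eq_sym in ij.
have [_ <-] := linked j i k ij ik jk.
exact: tr_UFS_square.
Qed.

Theorem theorem5p9 (g f : nat)
    (G : finZmodType) (H : 'M[G]_(g * 1)) (hH : @gen_hadamard g 1 G H)
    (S : finType) (L : 'I_f -> 'I_f -> 'M[S]_(g + 1)) (hL : linked_UFS L) :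
  exists A : 'I_f -> 'I_f -> 'M[int]_((g + 1) * g ^ 2),
    @linked_symGDD f (g ^ 2 * (g + 1)) (g * (g + 1)) (g + 1) (g ^ 2) g (g + 1)
      (2 * g) g A.
Proof.
have Ltr i j : i != j -> (L i j)^T = L j i by exact: tr_linked_UFS.
have [f3 latin linked] := hL.
have cardS : #|S| = (g + 1)%N.
  case: f f3 {Ltr hL linked} L latin => [|[|f']] // _ L latin.
  by have [] := latin ord0 ord_max isT.
have cardG := hH.1.
have [l l_inj] := gen_hadamard_net hH cardS.
pose C s := class_mx (l s).
have C_tr s : (C s)^T = C s by exact: tr_class_mx.
have C_sqr := mul_class_mx_id cardG cardS l_inj.
have C_mul := mul_class_mx_neq cardG l_inj.
have C_sum := sum_class_mx cardG cardS l_inj.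
have A_tr i j : i != j -> (subst_mx C (L i j))^T = subst_mx C (L j i).
  by move=> ij; rewrite tr_subst_mx // Ltr.
exists (fun i j => subst_mx C (L i j)); split=> //.
  move=> i j ij; split.
  - by rewrite mulnC.
  - by move=> p q; rewrite !mxE; case: eqP; [right|left].
  - by rewrite mulnDr muln1 blocks_mx_GDD; exact: mul_subst_mx_tr (latin _ _ ij).
  rewrite mulnDr muln1 blocks_mx_GDD.
  (* The column condition is the row condition for the transposed Latin square. *)
  rewrite -[X in _ *m X]trmxK tr_subst_mx //.
  exact/mul_subst_mx_tr/tr_latin_square/latin.
move=> i j k ij jk ik.
rewrite eq_sym in jk; have [ufs Lik] := linked i k j ik jk ij.
rewrite -(A_tr k j jk) (mul_subst_mx_UFS C_tr C_sqr C_mul ufs) Lik.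
(* The order [g + 1] leaves [g] columns of disagreement, and with [C] a block of the product's
   target, [g C + g J = 2 g C + g (J - C)]. *)
apply/matrixP=> p q.
case: (mxtens_indexP p) => a x; case: (mxtens_indexP q) => b y.
rewrite blocks_mxE !mxE !mxtens_indexK /= -subn1 addnK !mulr1 natrM mulrBr mulr1.
by rewrite -mulrA [2 * _]mulr_natl mulr2n [RHS]addrC addrA subrK addrC.
Qed.
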